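(* Let $k_1,k_2,n$ be positive integers with $k_1\le k_2$ and $k_1+k_2\ge 4$. If there exists a purely singular perfect $B[-k_1,k_2](2^n)$ set, then $2^n=k_1+k_2+1$.
   Context: For a positive integer $q$, $\mathbb{Z}_q$ is the ring of integers modulo $q$. For integers $a\le b$, $[a,b]^\ast=\{a,a+1,\dots,b\}\setminus\{0\}$. For non-negative integers $0\le k_1\le k_2$ and a positive integer $q$, a set $B\subseteq\mathbb{Z}_q$ is a $B[-k_1,k_2](q)$ set (splitter set) if, for each $b\in B$, the set $\{ab \bmod q: a\in[-k_1,k_2]^\ast\}$ consists of $k_1+k_2$ distinct nonzero elements, and these sets are pairwise disjoint for distinct $b\in B$. Such a set is perfect if $|B|=(q-1)/(k_1+k_2)$; equivalently, every nonzero element of $\mathbb{Z}_q$ has a unique representation $ab$ with $a\in[-k_1,k_2]^\ast$, $b\in B$ (and $0$ has no such representation). A perfect $B[-k_1,k_2](q)$ set is called purely singular if for every prime $p\mid q$ there is an integer $k$ with $0<k\le k_2$ and $p\mid k$. *)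

(* Defs.v *)
From HB Require Import structures.
From mathcomp Require Import all_boot all_order all_algebra.
Unset Strict Implicit. Unset Printing Implicit Defensive.
Import Order.TTheory GRing.Theory Num.Theory.
Local Open Scope ring_scope.

Definition int_interval_star (k1 k2 : nat) : seq int :=
  [seq x <- [seq (i%:Z - k1%:Z) | i <- iota 0 (k1 + k2).+1] | x != 0].

Definition mult_list (q k1 k2 : nat) (b : nat) : seq int :=
  [seq ((a * b%:Z) %% q%:Z)%Z | a <- int_interval_star k1 k2].

Definition splitter_set (q k1 k2 : nat) (B : {set 'I_q}) : Prop :=
  (forall b : 'I_q, b \in B ->
     uniq (mult_list q k1 k2 b) /\ all (fun x => x != 0) (mult_list q k1 k2 b))
  /\ (forall b b' : 'I_q, b \in B -> b' \in B -> b != b' ->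
     forall x, x \in mult_list q k1 k2 b -> x \notin mult_list q k1 k2 b').

Definition perfect_splitter_set (q k1 k2 : nat) (B : {set 'I_q}) : Prop :=
  splitter_set q k1 k2 B /\ (#|B| * (k1 + k2))%N = (q - 1)%N.

Definition purely_singular_perfect (q k1 k2 : nat) (B : {set 'I_q}) : Prop :=
  perfect_splitter_set q k1 k2 B /\
  (forall p : nat, prime p -> (p %| q)%N -> exists k : nat, (0 < k <= k2)%N /\ (p %| k)%N).

(* Main.v *)
(** Write k = k1 + k2, M = [-k1,k2]^* and q = 2^n.  Since k | q - 1, k is odd, so
    M has (k+1)/2 odd elements; as the products of the odd elements of M with
    the set Bo of odd elements of B are exactly the units of Z_q, (k+1)/2 = 2^m
    and |Bo| = 2^(n-1-m).  Suppose n <> m+1; as k | q - 1 also excludes n = m+2,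
    we have n >= m+3.  Whenever 2^i A is contained in M, the products A Bo are
    distinct modulo 2^(n-i), and for A consisting of odd numbers a count of
    units decides whether they exhaust the units.  If k2 >= 3 * 2^(m-1), then
    A = {1,3} gives a tiling modulo 2^(n-m+1), so that Bo is closed under
    multiplication by 9; a suitable power of 9 moves b in Bo to
    b + 2^(n-m), although elements of Bo are distinct modulo 2^(n-m).
    Otherwise A = {1,-1,3,c} with c = -3 or c = 5 gives a tiling modulo
    2^(n-m+2), so that Bo u -Bo is closed under multiplication by 9, and the
    same power argument contradicts the tiling by {1,-1} modulo 2^(n-m+1). *)
Require Import Defs.
From HB Require Import structures.
From mathcomp Require Import all_boot all_order all_algebra.
From mathcomp Require Import zify ring.
Set Implicit Arguments. Unset Strict Implicit. Unset Printing Implicit Defensive.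
Import Order.TTheory GRing.Theory Num.Theory.

Section Tilings.

Local Open Scope ring_scope.

(** * Direct products, and coverings of the units modulo a power of two *)

Definition direct_mod (q : int) (A B : seq int) : Prop :=
  forall a a' b b', a \in A -> a' \in A -> b \in B -> b' \in B ->
    (q %| a * b - a' * b')%Z -> a = a' /\ b = b'.

Lemma direct_mod_sub q A A' B B' :
  {subset A' <= A} -> {subset B' <= B} -> direct_mod q A B -> direct_mod q A' B'.
Proof.
move=> subA subB d a a' b b' /subA aA /subA a'A /subB bB /subB b'B.
exact: d.
Qed.

Lemma products_uniq (q : int) (A B : seq int) :
  uniq A -> uniq B -> direct_mod q A B ->
  uniq [seq ((a * b) %% q)%Z | a <- A, b <- B].
Proof.
move=> uA uB dAB; apply: allpairs_uniq => // -[a b] [a' b'].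
move=> /allpairsP[[x y] /= [Ax By [-> ->]]] /allpairsP[[x' y'] /= [Ax' By' [-> ->]]].
by move=> /eqP; rewrite eqz_mod_dvd => /(dAB _ _ _ _ Ax Ax' By By')[-> ->].
Qed.

(** Pigeonhole: directness makes the reduced products pairwise distinct, they lie in [s], and there
    are at least [size s] of them. *)
Lemma products_cover (q : int) (A B s : seq int) :
  uniq A -> uniq B -> direct_mod q A B ->
  (forall a b, a \in A -> b \in B -> ((a * b) %% q)%Z \in s) ->
  (size s <= size A * size B)%N ->
  forall z, z \in s -> exists a b, [/\ a \in A, b \in B & z = ((a * b) %% q)%Z].
Proof.
move=> uA uB dAB sub sz z zs.
set P := [seq ((a * b) %% q)%Z | a <- A, b <- B].
have subP : {subset P <= s} by move=> x /allpairsP[[a b] /= [aA bB ->]]; exact: sub.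
have szP : (size s <= size P)%N by rewrite size_allpairs.
have [_ eqm] := uniq_min_size (products_uniq uA uB dAB) subP szP.
move: zs; rewrite -eqm => /allpairsP[[a b] /= [aA bB ->]].
by exists a, b.
Qed.

Definition oddz (z : int) : bool := odd `|z|%N.

Lemma oddzM a b : oddz (a * b) = oddz a && oddz b.
Proof. by rewrite /oddz abszM oddM. Qed.

Lemma oddzDdouble a b : oddz (2 * a + b) = oddz b.
Proof. by rewrite /oddz; lia. Qed.

Lemma oddz_mod_pow2 N z : (0 < N)%N -> oddz (z %% (2 ^+ N))%Z = oddz z.
Proof.
case: N => // N _; rewrite {2}(divz_eq z (2 ^+ N.+1)) exprS.
by rewrite mulrCA oddzDdouble.
Qed.

(** For [N > 0] these represent the units modulo [2 ^ N]. *)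
Definition odd_residues (N : nat) : seq int :=
  [seq i.*2.+1%:Z | i <- iota 0 (2 ^ N.-1)].

Lemma odd_residues_uniq N : uniq (odd_residues N).
Proof. by rewrite map_inj_uniq ?iota_uniq // => i j; lia. Qed.

Lemma mem_odd_residues N z : (0 < N)%N ->
  (z \in odd_residues N) = [&& 0 <= z, z < 2 ^+ N & oddz z].
Proof.
case: N => // N _; rewrite /odd_residues /=.
have -> : (2 : int) ^+ N.+1 = (2 * 2 ^ N)%N by rewrite -expnS -natz natrX.

apply/mapP/and3P => [[i + ->]|[z0 zN oz]].
  by rewrite mem_iota /oddz => ?; split; lia.
exists (`|z|./2)%N; rewrite ?mem_iota; move: oz; rewrite /oddz; lia.
Qed.

Lemma mem_odd_residues_mod N z : (0 < N)%N -> oddz z ->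
  (z %% (2 ^+ N))%Z \in odd_residues N.
Proof.
move=> N0 oz; rewrite mem_odd_residues // oddz_mod_pow2 // oz.
by rewrite modz_ge0 ?expf_neq0 // ltz_pmod // exprn_gt0.
Qed.

Lemma odd_cover N (A B : seq int) :
  (0 < N)%N -> uniq A -> uniq B -> all oddz A -> all oddz B ->
  direct_mod (2 ^+ N) A B -> (size A * size B)%N = (2 ^ N.-1)%N ->
  forall z, oddz z ->
    exists a b, [/\ a \in A, b \in B & (2 ^+ N %| z - a * b)%Z].
Proof.
move=> N0 uA uB /allP oA /allP oB dAB sz z oz.
have [||a [b [aA bB e]]] := products_cover uA uB dAB _ _ (mem_odd_residues_mod N0 oz).
- by move=> a b /oA a1 /oB b1; apply: mem_odd_residues_mod => //; rewrite oddzM a1.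
- by rewrite size_map size_iota sz.
by exists a, b; split => //; rewrite -eqz_mod_dvd; apply/eqP.
Qed.

(** * Powers of 9 and impossible tilings of the units *)

Lemma expr9_pow2 j : exists w : int, 9 ^+ (2 ^ j) = 1 + 2 ^+ j.+3 * (1 + 2 * w).
Proof.
elim: j => [|j [w IH]]; first by exists 0.
(* With [t = 1 + 2 * w], squaring [1 + 2 ^+ j.+3 * t] gives
   [1 + 2 ^+ j.+4 * (t + 2 ^+ j.+2 * t ^+ 2)], and the last factor is again odd. *)
exists (w + 2 ^+ j.+1 * (1 + 2 * w) ^+ 2).
by rewrite expnSr exprM IH !exprS expr0; ring.
Qed.

(** Multiplication by [9 ^+ (2 ^ j)] shifts an odd [u] by an odd multiple of [2 ^+ j.+3]. *)
Lemma closed_under_9 (S : int -> Prop) j u :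
  (forall v, S v -> S (9 * v)) -> S u -> oddz u ->
  exists v, [/\ S v, (2 ^+ j.+3 %| v - u)%Z & ~~ (2 ^+ j.+4 %| v - u)%Z].
Proof.
move=> S9 Su ou; exists (9 ^+ (2 ^ j) * u).
have S9X i : S (9 ^+ i * u).
  by elim: i => [|i IH]; rewrite ?mul1r // exprS -mulrA; exact: S9.
have := S9X (2 ^ j)%N; have [w ->] := expr9_pow2 j => Sv.
have -> : (1 + 2 ^+ j.+3 * (1 + 2 * w)) * u - u = 2 ^+ j.+3 * ((1 + 2 * w) * u).
  by ring.
split=> //; first exact: dvdz_mulr.
rewrite [2 ^+ j.+4]exprSr dvdz_mul2l ?expf_neq0 //=.
have : oddz ((1 + 2 * w) * u) by rewrite oddzM ou /oddz; lia.
by rewrite /oddz; lia.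
Qed.

Lemma dvdz_lincomb (q x y z k l : int) :
  (q %| x)%Z -> (q %| y)%Z -> z = k * x + l * y -> (q %| z)%Z.
Proof. by move=> qx qy ->; rewrite rpredD // dvdz_mull. Qed.

Lemma dvdz_pow2_cancel N c z :
  oddz c -> (2 ^+ N %| c * z)%Z -> (2 ^+ N %| z)%Z.
Proof.
move=> oc; rewrite Gauss_dvdzr // /coprimez /gcdz abszX.
by have -> : gcdn (2 ^ N) `|c|%N = 1%N by apply/eqP; rewrite -/(coprime _ _) coprimeXl // coprime2n.
Qed.

(** Closure would put some [v] in [S] that agrees with [b] modulo [2 ^+ j.+3] but not modulo
    [2 ^+ j.+4]. Writing [v] as [e * b'] modulo [2 ^+ j.+4], directness at the smaller modulus
    forces [e = 1] and [b' = b], which is absurd. *)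
Lemma direct_not_closed_under_9 j (E B : seq int) :
  1 \in E -> all oddz B -> (0 < size B)%N -> direct_mod (2 ^+ j.+3) E B ->
  let S u := exists e b, [/\ e \in E, b \in B & (2 ^+ j.+4 %| u - e * b)%Z] in
  ~ (forall u, S u -> S (9 * u)).
Proof.
move=> E1 /allP oB; case: B oB => // b B oB _ dEB S S9.
have bB : b \in b :: B by rewrite mem_head.
have Sb : S b by exists 1, b; rewrite mul1r subrr.
have [v [[e [b' [eE b'B vb']]] vb nvb]] := closed_under_9 j S9 Sb (oB _ bB).
case: (dEB e 1 b' b) => // [|e1 bb']; last by move: vb'; rewrite e1 bb' mul1r (negPf nvb).
have vb'3 : (2 ^+ j.+3 %| v - e * b')%Z.
  by apply: dvdz_trans vb'; rewrite [2 ^+ j.+4]exprS dvdz_mull.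
by apply: (dvdz_lincomb (k := 1) (l := -1) vb vb'3); ring.
Qed.

(** By counting, [9 * u] is in [B] or [3 B] modulo [2 ^+ j.+4]. In the second case [3 * u] would be
    in [B], so [B] and [3 B] would meet; hence [B] is closed under 9. *)
Lemma no_tiling_1_3 j (B : seq int) :
  uniq B -> all oddz B -> (2 * size B)%N = (2 ^ j.+3)%N ->
  direct_mod (2 ^+ j.+3) [:: 1] B -> ~ direct_mod (2 ^+ j.+4) [:: 1; 3] B.
Proof.
move=> uB oB sB d1 d13.
have B0 : (0 < size B)%N by move: (expn_gt0 2 j.+3); lia.
apply: (direct_not_closed_under_9 (mem_head _ _) oB B0 d1).
move=> u [e [b [+ bB ub]]]; rewrite inE => /eqP e1; move: ub; rewrite {}e1 => ub.
have ou : oddz (9 * u).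
  have ob := allP oB _ bB; move: ub => /dvdzP[k]; rewrite !exprS.
  by move: (2 ^+ j) ob => p; rewrite /oddz; lia.
have [a [b' [+ b'B ub']]] := @odd_cover j.+4 [:: 1; 3] _ isT isT uB isT oB d13 sB _ ou.
rewrite !inE => /orP[] /eqP ea; move: ub'; rewrite {}ea => ub'.
  by exists 1, b'; rewrite inE.
have ub3 : (2 ^+ j.+4 %| 3 * u - b')%Z.
  by apply: (@dvdz_pow2_cancel _ 3) => //; rewrite mulrBr mulrA.
case: (d13 3 1 b b'); rewrite ?inE //.
by apply: (dvdz_lincomb (k := -3) (l := 1) ub ub3); ring.
Qed.

(** Here the set closed under 9 is the union of [B] and [- B]: the classes of 3 and [c] have to be
    ruled out for [9 * u]. *)
Lemma no_tiling_pm1_3 j c (B : seq int) :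
  c = -3 \/ c = 5 ->
  uniq B -> all oddz B -> (4 * size B)%N = (2 ^ j.+3)%N ->
  direct_mod (2 ^+ j.+3) [:: 1; -1] B ->
  ~ direct_mod (2 ^+ j.+4) [:: 1; -1; 3; c] B.
Proof.
move=> hc uB oB sB d1 d4.
have B0 : (0 < size B)%N by move: (expn_gt0 2 j.+3); lia.
apply: (direct_not_closed_under_9 (mem_head _ _) oB B0 d1).
move=> u [e [b [eE bB ub]]].
have e1 : e = 1 \/ e = -1 by move: eE; rewrite !inE => /orP[] /eqP; [left|right].
have ou : oddz (9 * u).
  have ob := allP oB _ bB; move: ub => /dvdzP[k]; rewrite !exprS.
  by move: (2 ^+ j) ob e1 => p; rewrite /oddz => ob [] ->; lia.
have oN : oddz (- (9 * u)) by move: ou; rewrite /oddz; lia.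
have uA : uniq [:: 1; -1; 3; c] by case: hc => ->.
have oA : all oddz [:: 1; -1; 3; c] by case: hc => ->.
have cover := @odd_cover j.+4 _ _ isT uA uB oA oB d4 sB.
(* [3 u] is not [+- b'], because [u] is [+- b] and [3 b] differs from [+- b'] *)
have no3 s b' : s = 1 \/ s = -1 -> b' \in B ->
    (2 ^+ j.+4 %| 9 * u - 3 * s * b')%Z -> False.
  move=> hs b'B d.
  have d' : (2 ^+ j.+4 %| 3 * u - s * b')%Z.
    by apply: (@dvdz_pow2_cancel _ 3) => //; rewrite mulrBr !mulrA.
  case: (d4 3 (e * s) b b') => //; try by case: e1 hs => -> [] ->.
  apply: (dvdz_lincomb (k := -3 * e) (l := e) ub d').
  by case: e1 => ->; ring.
have pm s b' : s = 1 \/ s = -1 -> b' \in B -> (2 ^+ j.+4 %| 9 * u - s * b')%Z ->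
    exists e0 b0, [/\ e0 \in [:: 1; -1], b0 \in B & (2 ^+ j.+4 %| 9 * u - e0 * b0)%Z].
  by move=> hs b'B d; exists s, b'; split=> //; case: hs => ->.
have flip x y : (2 ^+ j.+4 %| - (9 * u) - x * y)%Z -> (2 ^+ j.+4 %| 9 * u - (- x) * y)%Z.
  by move=> d; apply: (dvdz_lincomb (k := -1) (l := 0) d d); ring.
have [a [b1 [aA b1B d]]] := cover _ ou.
(* For [c = 5] the tiling is not symmetric under negation, so [- (9 * u)] is located as well. *)
have [a' [b2 [a'A b2B d']]] := cover _ oN.
move: aA; rewrite !inE => /or4P[] /eqP ea; rewrite {}ea in d.
- exact: (pm 1 b1 (or_introl erefl)).
- exact: (pm (-1) b1 (or_intror erefl)).
- by case: (no3 1 b1 (or_introl erefl)).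
case: hc => hc; first by case: (no3 (-1) b1 (or_intror erefl) b1B); rewrite hc in d.
rewrite hc in d d4; move: a'A; rewrite hc !inE => /or4P[] /eqP ea; rewrite {}ea in d'.
- exact: (pm (-1) b2 (or_intror erefl) b2B (flip _ _ d')).
- exact: (pm 1 b2 (or_introl erefl) b2B (flip _ _ d')).
- by case: (no3 (-1) b2 (or_intror erefl) b2B (flip _ _ d')).
(* Now [9 * u] and [- (9 * u)] are both in [5 B]; adding and cancelling 5 gives [b1 = - b2] modulo
   [2 ^+ j.+4], against directness. *)
case: (d4 1 (-1) b1 b2) => //.
apply: (@dvdz_pow2_cancel _ 5) => //.
by apply: (dvdz_lincomb (k := -1) (l := -1) d d'); ring.
Qed.

(** * The factor interval and its odd elements *)

Lemma mem_int_interval_star k1 k2 (x : int) :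
  (x \in int_interval_star k1 k2) = [&& x != 0, - k1%:Z <= x & x <= k2%:Z].
Proof.
rewrite mem_filter; congr (_ && _); apply/mapP/andP => [[i + ->]|[x1 x2]].
  by rewrite mem_iota; lia.
by exists `|(x + k1%:Z)%R|%N; rewrite ?mem_iota; lia.
Qed.

Lemma shifted_iota_uniq (c : int) s m : uniq [seq i%:Z - c | i <- iota s m].
Proof. by rewrite map_inj_uniq ?iota_uniq // => i j; lia. Qed.

Lemma int_interval_star_uniq k1 k2 : uniq (int_interval_star k1 k2).
Proof. exact/filter_uniq/shifted_iota_uniq. Qed.

Lemma size_int_interval_star k1 k2 : size (int_interval_star k1 k2) = (k1 + k2)%N.
Proof.
have u := shifted_iota_uniq k1%:Z 0 (k1 + k2).+1.
rewrite /int_interval_star -(rem_filter 0 u) size_rem ?size_map ?size_iota //.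
by apply/mapP; exists k1; rewrite ?mem_iota ?subrr //; lia.
Qed.

(** Of two consecutive integers exactly one is odd. *)
Lemma size_odd_shifted_iota (c : int) s l :
  size [seq x <- [seq i%:Z - c | i <- iota s l.*2] | oddz x] = l.
Proof.
elim: l s => //= l IH s; have := IH s.+2.
have -> : oddz (s.+1%:Z - c) = ~~ oddz (s%:Z - c) by rewrite /oddz; lia.
by case: (oddz _) => /= ->.
Qed.

Lemma size_odd_int_interval_star k1 k2 l : (k1 + k2).+1 = l.*2 ->
  size [seq x <- int_interval_star k1 k2 | oddz x] = l.
Proof.
move=> kl; rewrite /int_interval_star kl -filter_predI -[RHS](size_odd_shifted_iota k1%:Z 0).
by congr (size _); apply: eq_filter => x /=; case: eqP => [->|]; rewrite ?andbT.
Qed.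

Lemma map_uniq_inj (T1 T2 : eqType) (f : T1 -> T2) (s : seq T1) :
  uniq (map f s) -> {in s &, injective f}.
Proof.
move=> u x y xs ys fxy; rewrite -(nth_index x xs) -(nth_index x ys); congr nth.
have ixs : (index x s < size (map f s))%N by rewrite size_map index_mem.
have iys : (index y s < size (map f s))%N by rewrite size_map index_mem.
apply/eqP; rewrite -(nth_uniq (f x) ixs iys u).
by rewrite !(nth_map x) ?index_mem // !nth_index // fxy.
Qed.

(** * Splitter sets as direct products *)

Definition representatives (q : nat) (B : {set 'I_q}) : seq int :=
  [seq (nat_of_ord b)%:Z | b <- enum B].

Lemma representatives_uniq q (B : {set 'I_q}) : uniq (representatives B).
Proof. by rewrite map_inj_uniq ?enum_uniq // => b b' [] /val_inj. Qed.

Section PerfectSplitter.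

Variables (q k1 k2 : nat) (B : {set 'I_q}).

Local Notation M := (int_interval_star k1 k2).

Lemma splitter_direct :
  splitter_set q k1 k2 B -> direct_mod q%:Z M (representatives B).
Proof.
move=> [inj disj] a a' _ _ aM a'M /mapP[b + ->] /mapP[b' + ->].
rewrite !mem_enum => bB b'B; rewrite -eqz_mod_dvd => /eqP e.
case: (eqVneq b b') e => [<-|nbb'] e.
  by split=> //; apply: (map_uniq_inj (proj1 (inj b bB))).
have := disj b b' bB b'B nbb' ((a * b%:Z) %% q%:Z)%Z.
rewrite {2}e => /(_ (map_f _ aM)) /negP; case.
exact: (map_f (fun x : int => ((x * b'%:Z) %% q%:Z)%Z)).
Qed.

(** The products are nonzero residues, and perfection says that their number is [q - 1]. *)
Lemma perfect_cover : (0 < q)%N -> perfect_splitter_set q k1 k2 B ->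
  forall z : int, 0 < z < q%:Z ->
  exists a b, [/\ a \in M, b \in representatives B & z = ((a * b) %% q%:Z)%Z].
Proof.
move=> q0 [spl card] z zq.
apply: (products_cover (s := [seq i.+1%:Z | i <- iota 0 q.-1])
  (int_interval_star_uniq _ _) (representatives_uniq _) (splitter_direct spl)).
- move=> a _ aM /mapP[b + ->]; rewrite mem_enum => bB.
  have [_ /allP nz] := proj1 spl b bB.
  have := nz _ (map_f (fun a : int => ((a * b%:Z) %% q%:Z)%Z) aM).
  set r := (_ %% _)%Z => r0.
  have rq : 0 <= r < q%:Z by rewrite modz_ge0 ?ltz_pmod //; lia.
  by apply/mapP; exists `|r|.-1%N; rewrite ?mem_iota; lia.
- by rewrite size_map size_iota size_int_interval_star size_map -cardE mulnC card subn1.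
by apply/mapP; exists `|z|.-1%N; rewrite ?mem_iota; lia.
Qed.

End PerfectSplitter.

(** Modulo [2 ^ n] a product is odd exactly when both factors are, so the odd factors tile the
    units: directness gives one inequality, covering the other. *)
Lemma card_odd_factors n k1 k2 (B : {set 'I_(2 ^ n)}) :
  (0 < n)%N -> perfect_splitter_set (2 ^ n) k1 k2 B ->
  (size [seq a <- int_interval_star k1 k2 | oddz a] *
   size [seq b <- representatives B | oddz b] = 2 ^ n.-1)%N.
Proof.
move=> n0 pB; set A := filter _ _; set Bo := filter _ _.
have q2 : (2 ^ n)%N%:Z = 2 ^+ n by rewrite -natz natrX.
have q0 : (0 < 2 ^ n)%N by rewrite expn_gt0.
have uA : uniq A by rewrite filter_uniq ?int_interval_star_uniq.
have uB : uniq Bo by rewrite filter_uniq ?representatives_uniq.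
have dAB : direct_mod (2 ^+ n) A Bo.
  rewrite -q2; apply: direct_mod_sub (splitter_direct (proj1 pB));
  exact/mem_subseq/filter_subseq.
have szr : size (odd_residues n) = (2 ^ n.-1)%N by rewrite size_map size_iota.
rewrite -(size_allpairs (fun a b => ((a * b) %% 2 ^+ n)%Z)) -szr.
apply/eqP; rewrite eqn_leq; apply/andP; split; apply: uniq_leq_size.
- exact: products_uniq.
- move=> _ /allpairsP[[a b] /= [+ + ->]]; rewrite !mem_filter => /andP[oa _] /andP[ob _].
  by rewrite mem_odd_residues_mod // oddzM oa.
- exact: odd_residues_uniq.
move=> z; rewrite mem_odd_residues // => /and3P[z0 zq oz].
have zr : 0 < z < (2 ^ n)%N%:Z.
  by rewrite q2 zq andbT lt_neqAle z0 andbT; apply/eqP => ez; rewrite -ez in oz.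
have [a [b [aM bB e]]] := perfect_cover q0 pB zr.
move: oz; rewrite e q2 oddz_mod_pow2 // oddzM => /andP[oa ob].
by apply: (allpairs_f (fun a b => ((a * b) %% 2 ^+ n)%Z)); rewrite mem_filter ?oa ?ob.
Qed.

(** * Scaling by powers of two and the final case analysis *)

Lemma direct_mod_pow2_scale n i (A M B : seq int) : (i <= n)%N ->
  direct_mod (2 ^+ n) M B -> {in A, forall a, 2 ^+ i * a \in M} ->
  direct_mod (2 ^+ (n - i)) A B.
Proof.
move=> lein dM AM a a' b b' aA a'A bB b'B d.
have := dM _ _ b b' (AM _ aA) (AM _ a'A) bB b'B.
(* The factor [2 ^+ i] is cancelled from both the difference and the modulus. *)
rewrite -!mulrA -mulrBr -{1}(subnKC lein) exprD.
rewrite dvdz_mul2l ?expf_neq0 // => /(_ d)[e ->]; split=> //.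
by apply: mulfI e; rewrite expf_neq0.
Qed.

Lemma perfect_splitter_pow2 (k1 k2 n : nat) (B : {set 'I_(2 ^ n)}) :
  (0 < k1)%N -> (k1 <= k2)%N -> (4 <= k1 + k2)%N -> (0 < n)%N ->
  perfect_splitter_set (2 ^ n) k1 k2 B -> (2 ^ n)%N = (k1 + k2 + 1)%N.
Proof.
move=> k1_gt0 lek k4 n0 pB.
have [spl card] := pB.
have /(direct_mod_sub (fun _ => id) (mem_subseq (filter_subseq oddz _))) := splitter_direct spl.
set Bo := filter _ _; rewrite -natz natrX => dM.
have uB : uniq Bo by rewrite filter_uniq ?representatives_uniq.
have oB : all oddz Bo by rewrite filter_all.
have e2n : (2 ^ n = 2 * 2 ^ n.-1)%N by rewrite -expnS prednK.
have kodd : odd (k1 + k2).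
  have : odd (#|B| * (k1 + k2)) by rewrite card; move: (expn_gt0 2 n.-1); lia.
  by rewrite oddM => /andP[].
have kl : (k1 + k2).+1 = (k1 + k2).+1./2.*2 by lia.
have := card_odd_factors n0 pB; rewrite (size_odd_int_interval_star kl) -/Bo => lBo.
have /(dvdn_pfactor _ _ (isT : prime 2))[m lemn lm] : ((k1 + k2).+1./2 %| 2 ^ n.-1)%N.
  by rewrite -lBo dvdn_mulr.
rewrite lm in kl lBo.
(* [m = 0] and [m = 1] would give [k1 + k2 = 1] and [k1 + k2 = 3]. From here on [m = i.+2], so
   [k1 + k2 + 1 = 2 ^ i.+3]. *)
case: m lm lemn kl lBo => [|[|i]] lm lemn kl lBo; [by lia | by lia |].
rewrite !expnS in kl.
have [en|lt1] : n = i.+3 \/ (i.+3 < n)%N by lia.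
  by rewrite en !expnS; lia.
(* If [n = i.+4], then [2 ^ n - 1 = 2 * (k1 + k2) + 1], so [k1 + k2] would divide 1. *)
have [en|lt2] : n = i.+4 \/ (i.+4 < n)%N by lia.
  have : (k1 + k2 %| 2 ^ n - 1)%N by rewrite -card dvdn_mull.
  have -> : (2 ^ n - 1 = (k1 + k2) * 2 + 1)%N by rewrite en !expnS; lia.
  by rewrite dvdn_addr ?dvdn_mulr // dvdn1; lia.
have [j en] : exists j, n = (i.+4 + j).+1 by exists (n - i.+4.+1)%N; lia.
have sB : size Bo = (2 ^ j.+2)%N.
  apply/eqP; rewrite -(eqn_pmul2l (expn_gt0 2 i.+2 : (0 < 2 ^ i.+2)%N)) lBo -expnD en.
  by apply/eqP; congr expn; lia.
have dA s A : (s <= n)%N ->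
    (forall a, a \in A -> (2 ^ s)%N%:Z * a \in int_interval_star k1 k2) ->
    direct_mod (2 ^+ (n - s)) A Bo.
  by move=> sn sub; apply: (direct_mod_pow2_scale _ dM) => // a /sub; rewrite -natz natrX.
have p0 : (0 < 2 ^ i)%N by rewrite expn_gt0.
have [k2big|k2small] := leqP (3 * 2 ^ i.+1) k2.
  have d1 : direct_mod (2 ^+ j.+3) [:: 1] Bo.
    have -> : j.+3 = (n - i.+2)%N by lia.
    apply: dA => [|a]; first by lia.
    by rewrite inE mem_int_interval_star => /eqP->; rewrite !expnS in k2big *; lia.
  case: (no_tiling_1_3 uB oB _ d1); first by rewrite sB -expnS.
  have -> : j.+4 = (n - i.+1)%N by lia.
  apply: dA => [|a]; first by lia.
  rewrite !inE mem_int_interval_star => /orP[] /eqP->.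
    by rewrite !expnS in k2big *; lia.
  by rewrite !expnS in k2big *; lia.
(* Since [k2 < 3 * 2 ^ i.+1] and the sum is [2 ^ i.+3 - 1], both [k1] and [k2] are at least
   [2 ^ i.+1]. *)
have d1 : direct_mod (2 ^+ j.+4) [:: 1; -1] Bo.
  have -> : j.+4 = (n - i.+1)%N by lia.
  apply: dA => [|a]; first by lia.
  by rewrite !inE mem_int_interval_star !expnS in k2small * => /orP[] /eqP->; lia.
(* If [k1 < 3 * 2 ^ i], the sum forces [k2 >= 5 * 2 ^ i], so one of the two choices always fits in
   the interval. *)
have [c hc cM] : exists2 c : int, c = -3 \/ c = 5 &
    (2 ^ i)%N%:Z * c \in int_interval_star k1 k2.
  have [k1big|k1small] := leqP (3 * 2 ^ i) k1; [exists (-3) | exists 5];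
    rewrite ?mem_int_interval_star; by [left | right | lia].
case: (no_tiling_pm1_3 hc uB oB _ d1); first by rewrite sB -(expnD 2 2).
have -> : j.+1.+4 = (n - i)%N by lia.
apply: dA => [|a]; first by lia.
rewrite expnS in k2small.
rewrite !inE => /or4P[] /eqP-> //; rewrite mem_int_interval_star; lia.
Qed.

End Tilings.

Theorem theorem3p7 (k1 k2 n : nat) :
  (0 < k1)%N -> (k1 <= k2)%N -> (4 <= k1 + k2)%N -> (0 < n)%N ->
  (exists B : {set 'I_(2 ^ n)}, purely_singular_perfect (2 ^ n) k1 k2 B) ->
  2 ^ n = (k1 + k2 + 1)%N.
Proof.
by move=> k1_gt0 lek k4 n0 [B [pB _]]; apply: perfect_splitter_pow2 pB.
Qed.
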